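(* For all constants $a\in\mathbb{N}$, $b\in\mathbb{Z}$, $c\in\mathbb{R}_{>0}$, $d\in\mathbb{R}$, \[\limsup_{n\to\infty}\frac{\varphi(an+b)}{cn+d}=\frac{a\,\varphi((a,b))}{c\,(a,b)}\] and \[\liminf_{n\to\infty}\frac{\varphi(an+b)}{cn+d}=0.\]
   Context: $\mathbb{N}$ is the set of positive integers, $\varphi$ is Euler's totient function, and $(a,b)=\gcd(a,b)$. The variable $n$ runs through positive integers (large enough that $an+b>0$ and $cn+d>0$). *)

(* Defs.v *)
From HB Require Import structures.
From mathcomp Require Export all_boot all_order all_algebra.
From mathcomp Require Export all_classical all_reals all_analysis.

Set Implicit Arguments.
Unset Strict Implicit.
Unset Printing Implicit Defensive.

Import GRing.Theory Num.Theory.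
Local Open Scope ring_scope.

(* [totient] takes a natural number; it is used at [a * n + b] with [b : int].
   For [a > 0] this integer is positive for all large [n], where the absolute
   value does nothing; the finitely many other terms (and those where
   [c * n + d <= 0]) are finite and affect neither limsup nor liminf. *)
Definition totientz (m : int) : nat := totient `|m|%N.

(* Extended-real valued, so that the limsup and liminf exist a priori. *)
Definition totient_ratio (R : realType) (a : nat) (b : int) (c d : R)
    (n : nat) : \bar R :=
  ((totientz (a%:Z * n%:Z + b))%:R / (c * n%:R + d))%:E.

(* Main.v *)
Require Import Defs.
From mathcomp Require Import all_boot all_order all_algebra.
From mathcomp Require Import all_classical all_reals all_analysis.
From mathcomp Require Import cyclic zify ring lra.

(** Write g = gcd(a, b), a = g a', b = g b'.  Then a n + b = g m with
    m = a' n + b', and m runs through the large members of a residue class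
    coprime to a'.

    Everything rests on phi(g m) <= m phi(g), which counts the integers below
    g m that are coprime to g ([totient_mul_le]).  Dividing by c n + d, it gives
    the upper bound for the limsup.

    The same inequality also shows that phi(Q) / Q can be made arbitrarily small
    with Q coprime to a prescribed a.  Indeed, for d | Q it says
    phi(Q) / d <= phi(Q / d), and Gauss's identity
    sum_(d | Q) phi(Q / d) = Q yields phi(Q) * sum_(d | Q) 1 / d <= Q; with Q the
    product of the numbers a j + 1 for j < 2 ^ K the sum of 1 / d is at least
    of order K / a ([coprime_totient_small]).  Making m a multiple of such a Q
    in its class (Chinese remainders) gives liminf = 0.

    For the lower bound of the limsup one wants m in the class with
    phi(g m) >= (1 - e) phi(g) m.  A prime m would do, but Dirichlet's theorem
    can be avoided.  Choose m by Chinese remainders in the class b' mod a' and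
    congruent to 1 modulo the product P of the primes p < y not dividing a';
    then m has no prime factor below y, while m < 3 a' P <= y ^ (pi(y) + 1)
    as soon as y >= 3 a', where pi(y) is the number of primes below y.
    Since y ^ omega(m) <= m, where omega(m) is the number of prime factors,
    omega(m) <= pi(y) ([rough_in_class]).  The union bound
    m - phi(m) <= sum_(p | m) m / p <= omega(m) m / y ([totient_ge_primes]) then
    leaves only pi(y) / y -> 0 to be shown, along some sequence of y.  For
    y = k Q this follows from phi(Q) / Q being small, as all primes but those
    dividing Q are coprime to Q ([prime_count_small]). *)

Set Implicit Arguments.
Unset Strict Implicit.
Unset Printing Implicit Defensive.

Import Order.TTheory GRing.Theory Num.Theory.
Import numFieldNormedType.Exports.

Local Open Scope nat_scope.

(** * Counting coprime residues *)

(** Coprimality to g is periodic of period g. *)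
Lemma sum_coprime_periods k g :
  \sum_(0 <= i < k * g) coprime g i = k * totient g.
Proof.
rewrite big_nat_mul; elim: k => [|k IHk]; first by rewrite big_nil.
rewrite big_nat_recr //= IHk [RHS]mulSnr; apply/eqP; rewrite eqn_add2l; apply/eqP.
rewrite -{1}[k * g]add0n big_addn mulSn addnK totient_count_coprime.
by apply: eq_big_nat => j _; rewrite /coprime addnC gcdnMDl.
Qed.

(** Being coprime to g m is stronger than being coprime to g. *)
Lemma totient_mul_le g m : totient (g * m) <= m * totient g.
Proof.
rewrite -sum_coprime_periods totient_count_coprime (mulnC g).
by apply: leq_sum => i _; rewrite coprimeMl; case: coprime; case: coprime.
Qed.

(** * Small values of phi(Q) / Q *)

(** Each dyadic block 2 ^ k <= j < 2 ^ (k + 1) contributes at least c / (2 a) to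
    the sum, as a j + 1 <= a 2 ^ (k + 1) there: this is the divergence of the
    series of the 1 / (a j + 1), kept free of fractions. *)
Lemma dyadic_sum_ge a c (F : nat -> nat) K : 0 < a ->
    (forall j, 0 < j < 2 ^ K -> c <= (a * j + 1) * F j) ->
  K * c <= 2 * a * \sum_(1 <= j < 2 ^ K) F j.
Proof.
move=> a_gt0; elim: K => // K IHK cF.
have lt2 : 2 ^ K < 2 ^ K.+1 by rewrite ltn_exp2l.
have pos : 0 < 2 ^ K by rewrite expn_gt0.
rewrite (@big_cat_nat _ _ _ (2 ^ K)) ?(ltnW lt2) //= mulnDr mulSnr.
apply: leq_add; first by apply: IHK => j /andP[j0 jK]; apply: cF; lia.
rewrite -(leq_pmul2l pos) [X in _ <= X]mulnA big_distrr /=.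
rewrite -[X in X * c](_ : \sum_(2 ^ K <= j < 2 ^ K.+1) 1 = _); last first.
  by rewrite sum_nat_const_nat muln1 expnS; lia.
rewrite big_distrl /= big_nat [X in _ <= X]big_nat; apply: leq_sum => j /andP[j_ge j_lt].
rewrite mul1n; apply: leq_trans (cF j _) _; first by lia.
by rewrite leq_mul2r expnS in j_lt *; apply/orP; right; nia.
Qed.

(** The numbers Q / (a j + 1) are distinct divisors of Q, so their totients sum to
    at most Q by Gauss's identity, and each totient is at least
    phi(Q) / (a j + 1). *)
Lemma totient_mul_sum_dyadic_le a K Q : 0 < a -> 0 < Q ->
    (forall j, 0 < j < 2 ^ K -> a * j + 1 %| Q) ->
  K * totient Q <= 2 * a * Q.
Proof.
move=> a_gt0 Q_gt0 dvQ; pose e j := Q %/ (a * j + 1).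
have eK j : 0 < j < 2 ^ K -> e j * (a * j + 1) = Q by move/dvQ/divnK.
apply: leq_trans (@dyadic_sum_ge a _ (totient \o e) K a_gt0 _) _ => [j jK|].
  by rewrite -{1}(eK _ jK) totient_mul_le.
rewrite leq_mul2l; apply/orP; right; rewrite -[leqRHS]sum_totient_dvd.
rewrite -(big_mkord (fun d => d %| Q) totient) -[leqRHS]big_filter.
rewrite -(big_map e predT totient).
apply: (uniq_sub_le_big leqnn (fun x y => leq_addr y x)).
- rewrite map_inj_in_uniq ?iota_uniq // => i j; rewrite !mem_index_iota => iK jK eq_e.
  have := eK _ iK; rewrite eq_e -(eK _ jK) => /eqP.
  have e0 : 0 < e j by rewrite divn_gt0 addn1 // -addn1 dvdn_leq ?dvQ.
  by rewrite eqn_pmul2l // eqn_add2r eqn_pmul2l // => /eqP.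
- by rewrite filter_uniq ?iota_uniq.
move=> x /mapP[j]; rewrite mem_index_iota => jK ->.
rewrite mem_filter mem_index_iota /= ltnS -(eK _ jK).
by rewrite dvdn_mulr ?dvdnn //= -{1}[e j]muln1 leq_mul2l addn1 orbT.
Qed.

(** The factors a j + 1 are automatically coprime to a, so no primes have to be
    removed from Q afterwards. *)
Lemma coprime_totient_small a B : 0 < a ->
  exists Q, [/\ 0 < Q, coprime a Q & B * totient Q <= Q].
Proof.
move=> a_gt0; pose K := 2 * a * B; pose Q := \prod_(1 <= j < 2 ^ K) (a * j + 1).
have Q_gt0 : 0 < Q by rewrite /Q prodn_gt0 // => j; rewrite addn1.
exists Q; split=> //.
  rewrite /Q; apply big_ind => [|x y cx cy|j _]; rewrite ?coprimen1 ?coprimeMr ?cx //.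
  by rewrite /coprime mulnC gcdnMDl gcdn1.
rewrite -(@leq_pmul2l (2 * a)) ?muln_gt0 //= mulnA; apply: totient_mul_sum_dyadic_le => //.
move=> j jK; rewrite /Q (bigD1_seq j) ?iota_uniq ?mem_index_iota //=.
by rewrite dvdn_mulr.
Qed.

(** * Primes have density zero *)

Definition prime_count y := \sum_(0 <= p < y) prime p.

(** The prime number density vanishes along the multiples y of a Q with small
    phi(Q) / Q: below k Q there are k phi(Q) integers coprime to Q, and a prime
    that is not among them is at most Q. *)
Lemma prime_count_small B N : exists y, N <= y /\ B * prime_count y <= y.
Proof.
have [Q [Q_gt0 _ tQ]] := coprime_totient_small (2 * B) (ltn0Sn 0).
(* Half of k Q absorbs B k phi(Q), by the choice of Q; since k >= 4 B, the other
   half absorbs B (Q + 1). *)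
pose k := N + 4 * B; exists (k * Q).
split; first by rewrite -[N]muln1 leq_mul //; lia.
have bnd : prime_count (k * Q) <= k * totient Q + Q.+1.
  rewrite -sum_coprime_periods.
  have dQ : \sum_(0 <= p < k * Q) (p <= Q) <= Q.+1.
    rewrite -big_mkcond /= -big_filter sum1_size -[X in _ <= X](size_iota 0).
    apply: uniq_leq_size; first by rewrite filter_uniq ?iota_uniq.
    by move=> p; rewrite mem_filter mem_iota ltnS => /andP[].
  apply: leq_trans (leq_add (leqnn _) dQ); rewrite -big_split /=.
  apply: leq_sum => p _; case pp: (prime p) => //; rewrite coprime_sym prime_coprime //.
  by have [pQ|_] := boolP (p %| Q); [rewrite (dvdn_leq Q_gt0 pQ)|rewrite leq_addr].
have := leq_mul (leqnn k) tQ; rewrite /k in bnd *; nia.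
Qed.

(** * Integers without small prime factors *)

(** Union bound over the prime factors p of m for the i < m that are not coprime
    to m: each p accounts for m / p <= m / y of them. *)
Lemma totient_ge_primes y m : 0 < y -> (forall p, prime p -> p %| m -> y <= p) ->
  y * m <= y * totient m + size (primes m) * m.
Proof.
move=> y_gt0 ym; have [->|m_gt0] := posnP m; first by rewrite !muln0.
have E p : p \in primes m -> \sum_(0 <= i < m) (p %| i) = m %/ p.
  rewrite mem_primes => /and3P[pp _ pm].
  rewrite -{1}(divnK pm) big_nat_mul.
  rewrite -[RHS]muln1 -[X in _ = X * 1]subn0 -sum_nat_const_nat; apply: eq_bigr => i _.
  rewrite mulSn addnC big_ltn ?ltn_ndaddr ?prime_gt0 // ?dvdn_mull //; last first.
    by rewrite -{1}[i * p]addn0 ltn_add2l prime_gt0.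
  rewrite big_nat_cond big1 ?addn0 // => j; rewrite andbT => /andP[j1 j2].
  case dj: (p %| j) => //; move/dvdnP: dj => [q jq]; subst j.
  by rewrite -mulSnr !ltn_mul2r in j1 j2; lia.
have le1 : m <= totient m + \sum_(p <- primes m) (m %/ p).
  rewrite -{1}[m]muln1 -{1}[m]subn0 -sum_nat_const_nat totient_count_coprime.
  rewrite -(eq_big_seq _ E) exchange_big -big_split /=.
  rewrite big_seq [leqRHS]big_seq; apply: leq_sum => i.
  rewrite mem_index_iota => /= im.
  have [c|] := boolP (coprime m i) => //=.
  have [->|i_gt0] := posnP i.
    rewrite /coprime gcdn0 => m1.
    (* i = 0 is divisible by every prime factor of m *)
    have : pdiv m \in primes m by rewrite mem_primes pdiv_prime ?pdiv_dvd ?m_gt0 //; lia.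
    by move=> h; rewrite (bigD1_seq (pdiv m)) ?primes_uniq //= dvdn0.
  rewrite coprime_has_primes // negbK => /hasP[p pi pm].
  move: pi; rewrite mem_primes => /and3P[_ _ pi].
  by rewrite (bigD1_seq p) ?primes_uniq //= pi.
have le2 : y * (\sum_(p <- primes m) (m %/ p)) <= size (primes m) * m.
  rewrite big_distrr /= -sum1_size big_distrl /=.
  rewrite big_seq [leqRHS]big_seq; apply: leq_sum => p.
  rewrite mem_primes => /and3P[pp _ pm]; rewrite mul1n mulnC.
  by rewrite -{2}(divnK pm) leq_mul2l ym ?orbT.
by have := leq_mul (leqnn y) le1; lia.
Qed.

Lemma expn_size_primes_le y m : 0 < m -> (forall p, prime p -> p %| m -> y <= p) ->
  y ^ size (primes m) <= m.
Proof.
move=> m_gt0 ym; rewrite [leqRHS](prod_prime_decomp m_gt0) prime_decompE big_map /=.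
rewrite -sum1_size expn_sum big_seq [leqRHS]big_seq; apply: leq_prod => p pm.
have := pm; rewrite mem_primes expn1 => /and3P[pp _ dv].
apply: leq_trans (ym _ pp dv) _; rewrite -[leqLHS]expn1 leq_exp2l ?prime_gt1 //.
by rewrite logn_gt0.
Qed.

(** Integers of a reduced residue class that behave like primes: no prime factor
    below y, and so few prime factors that they lose a negligible proportion of
    their totient. *)
Lemma rough_in_class a b y : 0 < a -> coprime a b -> 3 * a <= y ->
  exists m, [/\ y <= m, m = b %[mod a], forall p, prime p -> p %| m -> y <= p
               & size (primes m) <= prime_count y].
Proof.
move=> a_gt0 ab ay.
pose P := \prod_(0 <= p < y | prime p && ~~ (p %| a)) p.
have P_gt0 : 0 < P by rewrite prodn_cond_gt0 // => p /andP[/prime_gt0].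
have aP : coprime a P.
  apply: (big_ind (fun x => coprime a x)) => [|u v cu cv|p /andP[pp pa]].
  - exact: coprimen1.
  - by rewrite coprimeMr cu.
  - by rewrite coprime_sym prime_coprime.
have Py : P <= y ^ prime_count y.
  rewrite expn_sum /P big_mkcond /= big_nat [leqRHS]big_nat; apply: leq_prod => p /= py.
  case: (prime p) => //=; rewrite expn1; case: (p %| a) => //=; lia.
pose M := a * P; have M_gt0 : 0 < M by rewrite muln_gt0 a_gt0.
(* The offset 2 M excludes m = 1, which has no prime factor at all. *)
pose m := 2 * M + chinese a P b 1 %% M.
have lem : 2 * M <= m by exact: leq_addr.
have ltm : m < 3 * M by rewrite (mulSnr 2) ltn_add2l ltn_mod.
have ma : m = b %[mod a].
  by rewrite /m /M mulnCA [X in X + _]mulnC modnMDl modn_dvdm ?dvdn_mulr ?chinese_modl.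
have mP : m = 1 %[mod P].
  by rewrite /m /M mulnA modnMDl modn_dvdm ?dvdn_mull ?chinese_modr.
have rough p : prime p -> p %| m -> y <= p.
  move=> pp pm; rewrite leqNgt; apply/negP => py.
  have [pa|pa] := boolP (p %| a).
    have cm : coprime a m by rewrite -coprime_modr ma coprime_modr.
    by have := coprime_dvdl pa cm; rewrite prime_coprime // pm.
  have pP : p %| P.
    by rewrite /P (big_rem p) ?mem_index_iota /= ?pp ?pa ?dvdn_mulr.
  have cm : coprime P m by rewrite -coprime_modr mP coprime_modr coprimen1.
  by have := coprime_dvdl pP cm; rewrite prime_coprime // pm.
have m_gt1 : 1 < m by lia.
exists m; split=> //.
  apply: leq_trans (dvdn_leq _ (pdiv_dvd m)); last by lia.
  by apply: rough; rewrite ?pdiv_prime ?pdiv_dvd.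
have y_gt1 : 1 < y by lia.
rewrite -ltnS -(ltn_exp2l _ _ y_gt1).
apply: leq_ltn_trans (expn_size_primes_le _ rough) _; first by lia.
(* m < 3 M = (3 a) P, where 3 a <= y and P <= y ^ prime_count y *)
apply: leq_trans ltm _; rewrite mulnA expnS; exact: leq_mul.
Qed.

(** * Extreme totients in a residue class *)

Lemma totient_large_in_class a b g B N : 0 < a -> coprime a b -> 0 < g ->
  exists m, [/\ N <= m, m = b %[mod a], coprime g m & B * m <= B * totient m + m].
Proof.
move=> a_gt0 ab g_gt0.
(* y > g makes m coprime to g, and y >= 3 a is needed for the rough m *)
have [y [Ny By]] := prime_count_small B (N + 3 * a + g.+1).
have [|m [ym mb rough wm]] := @rough_in_class a b y a_gt0 ab; first by lia.
have y_gt0 : 0 < y by lia.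
exists m; split=> //; first by lia.
  rewrite coprime_has_primes //; last by lia.
  apply/hasPn => p; rewrite !mem_primes => /and3P[pp _ pm]; apply/negP => /and3P[_ _ pg].
  by have := rough p pp pm; have := dvdn_leq g_gt0 pg; lia.
have := totient_ge_primes y_gt0 rough.
have : B * size (primes m) <= y by apply: leq_trans By; rewrite leq_mul2l wm orbT.
move=> h1 h2; rewrite -(leq_pmul2l y_gt0).
have := leq_mul (leqnn B) h2; have := leq_mul h1 (leqnn m).
rewrite !mulnDr !mulnA !(mulnC y) => *; lia.
Qed.

Lemma totient_small_in_class a b B N : 0 < a ->
  exists m, [/\ N <= m, m = b %[mod a] & B * totient m <= m].
Proof.
move=> a_gt0; have [Q [Q_gt0 aQ tQ]] := coprime_totient_small B a_gt0.
pose m := N * (a * Q) + chinese a Q b 0; exists m.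
have [k mk] : exists k, m = k * Q.
  by apply/dvdnP; rewrite /m mulnA /dvdn modnMDl chinese_modr // mod0n.
split.
- by apply: leq_trans (leq_addr _ _); rewrite leq_pmulr // muln_gt0 a_gt0.
- by rewrite /m mulnCA [X in X + _]mulnC modnMDl chinese_modl.
rewrite mk (mulnC k); apply: leq_trans (leq_mul (leqnn B) (totient_mul_le _ _)) _.
by rewrite mulnCA mulnC leq_mul2r tQ orbT.
Qed.

Local Open Scope ring_scope.

(** * Arithmetic progressions *)

Lemma progression_hit (a m N : nat) (b : int) : (0 < a)%N -> (a * N + `|b|%N <= m)%N ->
  (m = b %[mod a])%Z -> exists2 n, (N <= n)%N & a%:Z * n%:Z + b = m%:Z.
Proof.
move=> a0 Nm /eqP; rewrite eqz_mod_dvd => /dvdzP[q mq].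
have q_ge : (N%:Z <= q) by nia.
by exists `|q|%N; nia.
Qed.

Lemma gcdz_progression (a : nat) (b : int) : (0 < a)%N ->
  exists (g a' : nat) (b' : int), [/\ gcdz a%:Z b = g%:Z, (0 < g)%N,
    (a = g * a')%N, b = g%:Z * b' & coprime a' `|(b' %% a')%Z|%N ].
Proof.
move=> a0; pose g := gcdn a `|b|%N.
have g0 : (0 < g)%N by rewrite gcdn_gt0 a0.
have /dvdnP[a' aE] : (g %| a)%N by exact: dvdn_gcdl.
have /dvdzP[b' bE] : (g %| b)%Z by rewrite /dvdz; exact: dvdn_gcdr.
have a'0 : (0 < a')%N by rewrite aE muln_gt0 in a0; case/andP: a0.
exists g, a', b'; split => //; first by rewrite mulnC.
  by rewrite mulrC.
have [gE] : gcdz a' (b' %% a')%Z = gcdz a' b' by exact: gcdz_modr.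
rewrite /coprime gE -(eqn_pmul2r g0) mul1n muln_gcdl -aE.
by rewrite -[in X in gcdn a X](absz_nat g) -abszM -bE.
Qed.

Lemma totient_dvd_le g n : (g %| n)%N -> (g * totient n <= totient g * n)%N.
Proof.
move=> /dvdnP[m ->]; rewrite (mulnC m g) (mulnCA (totient g)) leq_mul2l.
by rewrite (mulnC (totient g)) totient_mul_le orbT.
Qed.

(** The index n for which a n + b = g m comes from an m coprime to g in the reduced
    class b' mod a'; coprimality to g turns phi(g m) into phi(g) phi(m). *)
Lemma progression_totient_large (a : nat) (b : int) (B N : nat) : (0 < a)%N ->
  let g := `|gcdz a%:Z b|%N in exists n m : nat,
  [/\ (N <= n)%N, a%:Z * n%:Z + b = m%:Z
     & (B * (totient g * m) <= B * (g * totient m) + totient g * m)%N].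
Proof.
move=> a0 g; have [g1 [a' [b' [gE g0 aE bE cop]]]] := gcdz_progression b a0.
have {}gE : g = g1 by rewrite /g gE. subst g1.
have a'0 : (0 < a')%N by rewrite aE muln_gt0 in a0; case/andP: a0.
have [m [Nm mb gm hm]] :=
  totient_large_in_class B (a' * N + `|b'|)%N a'0 cop g0.
have mb' : (m = b' %[mod a'])%Z.
  rewrite modz_nat mb -modz_nat gez0_abs ?modz_ge0 ?modz_mod //; lia.
have [n Nn nE] := progression_hit a'0 Nm mb'.
exists n, (g * m)%N; split=> //.
  by rewrite aE bE !PoszM -mulrA -mulrDr nE.
rewrite totient_coprime //; have := leq_mul (leqnn (totient g * g)%N) hm; nia.
Qed.

Lemma progression_totient_small (a : nat) (b : int) (B N : nat) : (0 < a)%N ->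
  exists n m : nat, [/\ (N <= n)%N, a%:Z * n%:Z + b = m%:Z & (B * totient m <= m)%N].
Proof.
move=> a0; have [m [Nm mb hm]] :=
  totient_small_in_class `|(b %% a)%Z| B (a * N + `|b|)%N a0.
have mb' : (m = b %[mod a])%Z.
  rewrite modz_nat mb -modz_nat gez0_abs ?modz_ge0 ?modz_mod //; lia.
have [n Nn nE] := progression_hit a0 Nm mb'.
by exists n, m.
Qed.

Local Open Scope classical_set_scope.

(** * Limits superior and ratios of affine sequences *)

(** Serves twice: for the ratio, with the majorant w given by the bound
    phi(g m) <= m phi(g), and for the opposite of the ratio, with w = 0. *)
Lemma limn_esup_dominated (R : realType) (u w : R ^nat) (L : R) :
    (\forall n \near \oo, u n <= w n) -> w n @[n --> \oo] --> L ->
    (forall e, 0 < e -> forall N, exists n, (N <= n)%N /\ w n - e <= u n) ->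
  limn_esup (EFin \o u) = L%:E.
Proof.
move=> uw wL freq; apply/le_anti/andP; split.
  apply/lee_addgt0Pr => e e0.
  pose V := [set n | u n <= L + e].
  have VF : \oo V.
    near=> n; apply: (@le_trans _ _ (w n)); first by near: n.
    by near: n; apply: (cvgr_le L wL); rewrite ltrDl.
  apply: (@le_trans _ _ (ereal_sup ((EFin \o u) @` V))).
    by apply: ereal_inf_lbound; exists V.
  by apply: ge_ereal_sup => _ [n Vn <-]; rewrite -EFinD lee_fin.
apply: le_ereal_inf_tmp => _ [V VF <-]; apply/lee_subgt0Pr => e e0.
have e2 : 0 < e / 2 by rewrite divr_gt0.
have [N _ VN] : \forall n \near \oo, V n /\ L - e / 2 <= w n.
  near=> n; split; first by near: n.
  by near: n; apply: (cvgr_ge L wL); rewrite gtrBl.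
have [n [Nn wn]] := freq _ e2 N; have [Vn Ln] := VN _ Nn.
apply: le_trans (ereal_sup_ubound _); last by exists n; first exact: Vn.
by rewrite /= -EFinB lee_fin; lra.
Unshelve. all: by end_near. Qed.

Lemma near_gt0_affine (R : realType) (c d : R) : 0 < c ->
  \forall n \near \oo, 0 < c * n%:R + d.
Proof.
move=> c0; near=> n.
have : - d / c < n%:R by near: n; exact: nbhs_infty_gtr.
by rewrite ltr_pdivrMr // => h; lra.
Unshelve. all: by end_near. Qed.

Lemma cvg_affine_ratio (R : realType) (a b c d : R) : 0 < c ->
  (a * n%:R + b) / (c * n%:R + d) @[n --> \oo] --> a / c.
Proof.
move=> c0; pose K := b - a * d / c.
(* K / (c n + d) is the difference between the ratio and its limit. *)
have lin : c * n%:R + d @[n --> \oo] --> +oo.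
  apply/cvgryPge => A; near=> n.
  have : 0 < c * n%:R + (d - A) by near: n; exact: near_gt0_affine.
  by move=> h; lra.
have inv : (c * n%:R + d)^-1 @[n --> \oo] --> (0 : R).
  by apply/gtr0_cvgV0 => //; exact: near_gt0_affine.
have -> : a / c = a / c + K * 0 by rewrite mulr0 addr0.
apply: cvg_trans (cvgD (cvg_cst (a / c)) (cvgM (cvg_cst K) inv)).
apply: near_eq_cvg; near=> n => /=.
have E x : 0 < c * x + d -> a / c + K * (c * x + d)^-1 = (a * x + b) / (c * x + d).
  by move=> x0; rewrite /K; field; apply/andP; split; lra.
by apply: E; near: n; exact: near_gt0_affine.
Unshelve. all: by end_near. Qed.

Lemma near_progression_nat (R : realType) (a : nat) (b : int) : (0 < a)%N ->
  \forall n \near \oo,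
    (`|(a%:Z * n%:Z + b)%R|%N)%:R = a%:R * n%:R + b%:~R :> R.
Proof.
move=> a0; near=> n.
have n_ge : (`|b| <= n)%N by near: n; exact: nbhs_infty_ge.
have pos : 0 <= a%:Z * n%:Z + b by nia.
by rewrite -[LHS]/((`|(a%:Z * n%:Z + b)%R|%N)%:Z%:~R) gez0_abs // rmorphD rmorphM.
Unshelve. all: by end_near. Qed.

(** * The limits superior and inferior *)

Theorem corollary15 (R : realType) (a : nat) (b : int) (c d : R)
    (a_gt0 : (0 < a)%N) (c_gt0 : 0 < c) :
  limn_esup (totient_ratio a b c d) =
    ((a%:R * (totientz (gcdz a%:Z b))%:R) / (c * (gcdz a%:Z b)%:~R))%:E /\
  limn_einf (totient_ratio a b c d) = 0%:E.
Proof.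
pose t n := `|(a%:Z * n%:Z + b)%R|%N; pose g := `|gcdz a%:Z b|%N.
have g_dvd n : (g %| t n)%N.
  by have : (gcdz a b %| a%:Z * n%:Z + b)%Z by rewrite rpredD ?dvdz_mulr ?dvdz_gcdl ?dvdz_gcdr.
have g_gt0 : 0 < g%:R :> R by rewrite ltr0n gcdn_gt0 a_gt0.
pose D n := c * n%:R + d.
pose u n := (totient (t n))%:R / D n; pose v n := (t n)%:R / D n.
have uE : totient_ratio a b c d = EFin \o u by [].
have D_gt0 : \forall n \near \oo, 0 < D n by exact: near_gt0_affine.
have vL : v n @[n --> \oo] --> a%:R / c.
  apply: (cvg_trans _ (@cvg_affine_ratio R a%:R b%:~R c d c_gt0)).
  apply: near_eq_cvg; near=> n; rewrite /v /t; congr (_ / _); apply/esym.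
  by near: n; exact: near_progression_nat.
pose C := a%:R / c + 1 : R.
have C_gt0 : 0 < C by rewrite ltr_wpDl ?divr_ge0 // ltW.
have [N0 _ N0P] : \forall n \near \oo, 0 < D n /\ v n <= C.
  near=> n; split; first by near: n.
  by near: n; apply: (cvgr_le _ vL); rewrite ltrDl.
have archi (x e : R) : 0 < x -> 0 < e -> exists2 B, (0 < B)%N & x / B%:R <= e.
  move=> x0 e0; have xe0 : 0 < x / e by rewrite divr_gt0.
  have xeB := archi_boundP (ltW xe0); have B0 := lt_trans xe0 xeB.
  exists (Num.bound (x / e)); first by rewrite -(ltr_nat R).
  by rewrite ler_pdivrMr // mulrC -ler_pdivrMr // ltW.
have phi_gt0 : 0 < (totient g)%:R :> R by rewrite ltr0n totient_gt0 -(ltr_nat R).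
split.
  have -> : a%:R * (totientz (gcdz a b))%:R / (c * (gcdz a b)%:~R)
          = (totient g)%:R / g%:R * (a%:R / c) :> R.
    have -> : (gcdz a b)%:~R = g%:R :> R by [].
    rewrite /totientz -/g; field; apply/andP; split; lra.
  rewrite uE; apply: (@limn_esup_dominated _ _ (fun n => (totient g)%:R / g%:R * v n)).
  - near=> n; have Dn : 0 < D n by near: n.
    rewrite /v mulrA ler_pM2r ?invr_gt0 // mulrAC ler_pdivlMr // -!natrM ler_nat.
    by rewrite mulnC totient_dvd_le.
  - exact: cvgMl_tmp.
  move=> e e0 N; have [B B0 BP] := @archi ((totient g)%:R / g%:R * C) e
    (mulr_gt0 (divr_gt0 phi_gt0 g_gt0) C_gt0) e0.
  have [n [m [Nn nE]]] := progression_totient_large b B (maxn N N0) a_gt0.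
  rewrite -/g => hm; have tn : t n = m by rewrite /t nE.
  move: Nn; rewrite geq_max => /andP[Nn N0n]; exists n; split=> //.
  have [Dn vC] := N0P n N0n.
  have B1 : 0 < B%:R :> R by rewrite ltr0n.
  (* The bound on the totient of [m], divided by B g D(n). *)
  have : (totient g)%:R / g%:R * v n <= u n + (totient g)%:R / g%:R * v n / B%:R.
    move: hm; rewrite -(ler_nat R) !(natrM, natrD) /u /v tn => hm.
    rewrite -subr_ge0; have -> : forall x y z : R, x / D n + y / g%:R * (z / D n) / B%:R
        - y / g%:R * (z / D n)
      = (B%:R * (g%:R * x) + y * z - B%:R * (y * z)) / (B%:R * g%:R * D n).
      by move=> x y z; field; rewrite !gt_eqF.
    by rewrite divr_ge0 ?subr_ge0 // ltW // !mulr_gt0.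
  have : (totient g)%:R / g%:R * v n / B%:R <= (totient g)%:R / g%:R * C / B%:R.
    by rewrite ler_pM2r ?invr_gt0 // ler_pM2l // divr_gt0.
  by lra.
rewrite uE /limn_einf.
have -> : (\- (EFin \o u))%E = EFin \o (fun n => - u n) by [].
rewrite (@limn_esup_dominated _ _ (fun=> 0) 0) ?oppe0 //.
- near=> n; have Dn : 0 < D n by near: n.
  by rewrite oppr_le0 divr_ge0 // ltW.
- exact: cvg_cst.
move=> e e0 N; have [B B0 BP] := @archi C e C_gt0 e0.
have [n [m [Nn nE hm]]] := progression_totient_small b B (maxn N N0) a_gt0.
have tn : t n = m by rewrite /t nE.
move: Nn; rewrite geq_max => /andP[Nn N0n]; exists n; split=> //.
have [Dn vC] := N0P n N0n.
have B1 : 0 < B%:R :> R by rewrite ltr0n.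
rewrite sub0r lerN2; apply: le_trans BP; rewrite ler_pdivlMr //.
apply: le_trans vC; rewrite /u /v tn mulrAC ler_pM2r ?invr_gt0 //.
by rewrite -natrM ler_nat mulnC.
Unshelve. all: by end_near. Qed.
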